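(* Let $(\Omega,\mathcal{F},P)$, $T$, $(\mathcal{F}_t)_{t\in\mathbb{Z}}$ be as in the context, let $(V,\mathcal{V})$ be a standard measurable space, let $X(\omega)\subseteq V$ be a non-empty set depending $\mathcal{F}_0$-measurably on $\omega\in\Omega$, and let $f(\omega,x)$ be a mapping assigning to every $\omega\in\Omega$ and every $x\in X(\omega)$ an element $f(\omega,x)\in X(T\omega)$. For each $\omega$ let $Y(\omega)$ be a non-empty subset of $X(\omega)$ equipped with a separable metric $\rho(\omega,x,y)$, $x,y\in Y(\omega)$. Assume: (A1) The extended mapping $\bar f(\omega,x)$ ($\omega\in\Omega$, $x\in V$) is $\mathcal{F}_1\times\mathcal{V}$-measurable. (A2) (a) The set-valued mapping $\omega\mapsto Y(\omega)$ is $\mathcal{F}_0$-measurable. (b) The function $\bar\rho(\omega,x,y)$, equal to $\rho(\omega,x,y)$ if $x,y\in Y(\omega)$ and to $+\infty$ otherwise, is $\mathcal{F}_0\times\mathcal{V}\times\mathcal{V}$-measurable. (c) For each $\omega$, the Borel measurable structure on $Y(\omega)$ induced by the metric $\rho(\omega,x,y)$ coincides with the measurable structure induced on $Y(\omega)$ by $\mathcal{V}$. (d) For each $\omega\in\Omega$ and $x\in Y(\omega)$ we have $f(\omega,x)\in Y(T\omega)$, and the mapping $f(\omega,\cdot):Y(\omega)\to Y(T\omega)$ is continuous with respect to the metric $\rho(\omega,x,y)$ on $Y(\omega)$ and the metric $\rho(T\omega,x,y)$ on $Y(T\omega)$. (A3) There is a sequence of $\mathcal{F}_0$-measurable sets $\Omega_0\subseteq\Omega_1\subseteq\dots\subseteq\Omega$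 such that $P(\Omega_m)\to 1$ and for each $m=0,1,\dots$ and $\omega\in\Omega_m$: (a) the set $X^{(m)}(\omega)$ is contained in $Y(\omega)$ and is compact with respect to the metric $\rho(\omega,x,y)$; (b) for all $x,y\in Y_{-m-1}(\omega)$ with $x\ne y$, $$\rho(\omega,f^{(m)}(\omega,x),f^{(m)}(\omega,y))<\rho_{-m-1}(\omega,x,y).$$ Consider the equation $$\xi(T\omega)=f(\omega,\xi(\omega))\quad\text{(a.s.)}.\qquad( * )$$ Then: (i) There exists an $\mathcal{F}_0$-measurable mapping $\xi:\Omega\to V$ such that $\xi(\omega)\in Y(\omega)$, equation $( * )$ holds, and $$\lim_{m(\omega)\le m\to\infty}\ \sup_{x\in X_{-m-1}(\omega)}\rho\bigl(\omega,\xi(\omega),f_0(\omega)\cdots f_{-m}(\omega)(x)\bigr)=0\quad\text{(a.s.)}.$$ (ii) If $\eta:\Omega\to V$ is any (not necessarily measurable) mapping for which $\eta(\omega)\in X(\omega)$ and equation $( * )$ holds (with $\eta$ in place of $\xi$), then $\eta=\xi$ with probability one.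
   Context: $(\Omega,\mathcal{F},P)$ is a complete probability space and $T:\Omega\to\Omega$ is an automorphism: a one-to-one (bijective) mapping such that $T$ and $T^{-1}$ are measurable and preserve $P$. $\dots\subseteq\mathcal{F}_{-1}\subseteq\mathcal{F}_0\subseteq\mathcal{F}_1\subseteq\dots$ is a filtration of sub-$\sigma$-algebras of $\mathcal{F}$ such that each $\mathcal{F}_t$ contains all sets in $\mathcal{F}$ of measure $0$, and which is invariant with respect to $T$: $\mathcal{F}_{t+1}=T^{-1}\mathcal{F}_t$ for each $t$. A measurable space is standard if it is isomorphic to a Borel subset of a complete separable metric space. A set $X(\omega)\subseteq V$ depends $\mathcal{F}_0$-measurably on $\omega$ (the set-valued mapping $\omega\mapsto X(\omega)$ is $\mathcal{F}_0$-measurable) if its graph $\{(\omega,x):x\in X(\omega)\}$ belongs to $\mathcal{F}_0\times\mathcal{V}$ (product $\sigma$-algebra). $\bar f(\omega,x)=f(\omega,x)$ if $x\in X(\omega)$ and $\bar f(\omega,x)=\infty$ if $x\notin X(\omega)$, where $\infty$ denotes a point added to $V$. For $k=0,\pm1,\pm2,\dots$ define $X_k(\omega)=X(T^k\omega)$, $Y_k(\omega)=Y(T^k\omega)$, $\rho_k(\omega,x,y)=\rho(T^k\omega,x,y)$, and $f_k(\omega,x)=f(T^{k-1}\omega,x)$ for $x\in X_{k-1}(\omega)$, so that $f_k(\omega)=f_k(\omega,\cdot)$ maps $X_{k-1}(\omega)$ into $X_k(\omega)$. For $m=0,1,2,\dots$ put $$f^{(m)}(\omega,x)=f_0(\omega)f_{-1}(\omega)\cdots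 f_{-m}(\omega)(x),\quad x\in X_{-m-1}(\omega)$$ (the product means composition of mappings), and $X^{(m)}(\omega)=f^{(m)}(\omega,X_{-m-1}(\omega))$. Given the sets $\Omega_m$ from (A3), put $\bar\Omega=\bigcup_m\Omega_m$ and $m(\omega)=\min\{i:\omega\in\Omega_i\}$ if $\omega\in\bar\Omega$, $m(\omega)=0$ otherwise. Then for almost all $\omega$ we have $\omega\in\Omega_m$ for all $m\ge m(\omega)$, so that $f_0(\omega)\cdots f_{-m}(\omega)(x)\in Y(\omega)$ for all $m\ge m(\omega)$ and $x\in X_{-m-1}(\omega)$; the limit in (i) is taken over $m\ge m(\omega)$. *)

(* Defs.v *)
From HB Require Import structures.
From mathcomp Require Import all_boot all_order all_algebra.
From mathcomp Require Import all_classical all_reals all_analysis.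
From mathcomp Require Import measurable_realfun.

Set Implicit Arguments.
Unset Strict Implicit.
Unset Printing Implicit Defensive.

Import Order.TTheory GRing.Theory Num.Theory.
Import numFieldNormedType.Exports.

Local Open Scope classical_set_scope.
Local Open Scope ring_scope.

Definition separable_space (M : topologicalType) : Prop :=
  exists2 D : set M, countable D & dense D.

Definition complete_space (M : uniformType) : Prop :=
  forall F : set_system M, ProperFilter F -> cauchy F -> exists x : M, F --> x.

Definition borel (M : topologicalType) : set_system M := <<s @open M >>.
Arguments borel M : clear implicits.

(* [phi] is an isomorphism of [V] with the Borel set [range phi], whose
   measurable subsets are the Borel sets of [M] contained in it. *)
Definition standard_space (R : realType) d (V : measurableType d) : Prop :=
  exists (M : metricType R) (phi : V -> M),
    [/\ complete_space M, separable_space M, injective phi,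
        borel M (range phi)
      & forall A : set V, measurable A <-> borel M (phi @` A)].

Section automorphism.
Context d (Omega : measurableType d) (R : realType) (P : probability Omega R).
Implicit Types T Tinv : Omega -> Omega.

Definition automorphism T Tinv : Prop :=
  [/\ cancel T Tinv /\ cancel Tinv T,
      measurable_fun setT T, measurable_fun setT Tinv,
      forall A, measurable A -> P (T @^-1` A) = P A
    & forall A, measurable A -> P (Tinv @^-1` A) = P A].

Definition invariant_filtration T (F : int -> set_system Omega) : Prop :=
  [/\ forall t, sigma_algebra setT (F t),
      forall t, F t `<=` measurable,
      forall s t, s <= t -> F s `<=` F t,
      forall t A, measurable A -> P A = 0%E -> F t A
    & forall t, F (t + 1) = [set T @^-1` A | A in F t]].

End automorphism.

Section measurability.
Context d (Omega : measurableType d) dV (V : measurableType dV).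
Implicit Types (G : set_system Omega) (Z : Omega -> set V).

Definition graph_measurable G Z : Prop :=
  measurable ([set p | Z p.1 p.2] : set (g_sigma_algebraType G * V)).

(* [V] with the added point [None], which is a measurable atom. *)
Definition add_infty : Type :=
  g_sigma_algebraType
    (image_set_system setT (@Some V) measurable : set_system (option V)).

HB.instance Definition _ := Measurable.on add_infty.

Definition fbar Z (f : Omega -> V -> V) (p : Omega * V) : add_infty :=
  if p.2 \in Z p.1 then Some (f p.1 p.2) else None.

End measurability.

(* The values of [mdist_on] outside [Y] are irrelevant. *)
Record metric_on (R : realType) (V : choiceType) (Y : set V) := MetricOn {
  mdist_on :> V -> V -> R ;
  mdist_onxx : forall x, Y x -> mdist_on x x = 0 ;
  mdist_on_eq : forall x y, Y x -> Y y -> mdist_on x y = 0 -> x = y ;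
  mdist_on_sym : forall x y, Y x -> Y y -> mdist_on x y = mdist_on y x ;
  mdist_on_triangle : forall y x z, Y x -> Y y -> Y z ->
    mdist_on x z <= mdist_on x y + mdist_on y z }.

Definition metric_sub (R : realType) (V : choiceType) (Y : set V)
  (rho : metric_on R Y) : Type := set_type Y.

Section metric_sub.
Context (R : realType) (V : choiceType) (Y : set V) (rho : metric_on R Y).

HB.instance Definition _ := Choice.copy (metric_sub rho) (set_type Y).

Definition sub_val (x : metric_sub rho) : V := set_val x.

Lemma sub_valP (x : metric_sub rho) : Y (sub_val x).
Proof. exact: set_valP. Qed.

Definition sub_dist (x y : metric_sub rho) : R := rho (sub_val x) (sub_val y).

Let sub_distxx x : sub_dist x x = 0.
Proof. exact/mdist_onxx/sub_valP. Qed.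

Let sub_dist_eq x y : sub_dist x y = 0 -> x = y.
Proof. by move=> /(mdist_on_eq (sub_valP x) (sub_valP y))/val_inj. Qed.

Let sub_dist_sym x y : sub_dist x y = sub_dist y x.
Proof. by apply: mdist_on_sym; exact: sub_valP. Qed.

Let sub_dist_triangle y x z : sub_dist x z <= sub_dist x y + sub_dist y z.
Proof. by apply: mdist_on_triangle; exact: sub_valP. Qed.

HB.instance Definition _ := @isMetric.Build R (metric_sub rho) sub_dist
  sub_distxx sub_dist_eq sub_dist_sym sub_dist_triangle.

End metric_sub.

Definition metric_sub_map (R : realType) (V : choiceType) (Y Y' : set V)
    (rho : metric_on R Y) (rho' : metric_on R Y') (g : V -> V)
    (gY : forall x, Y x -> Y' (g x)) (x : metric_sub rho) : metric_sub rho' :=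
  exist _ (g (sub_val x)) (mem_set (gY _ (sub_valP x))).
Arguments metric_sub_map {R V Y Y'} rho rho' {g} gY x.
Arguments sub_val {R V Y} rho x.

Definition rhobar (R : realType) (Omega : Type) (V : choiceType)
    (Y : Omega -> set V) (rho : forall w, metric_on R (Y w))
    (p : Omega * V * V) : \bar R :=
  if (p.1.2 \in Y p.1.1) && (p.2 \in Y p.1.1)
  then (rho p.1.1 p.1.2 p.2)%:E else +oo%E.

Section orbit.
Context (Omega V : Type) (T Tinv : Omega -> Omega).

Definition Tpow (k : int) : Omega -> Omega :=
  match k with Posz n => iter n T | Negz n => iter n.+1 Tinv end.

Definition fk (f : Omega -> V -> V) (k : int) (w : Omega) : V -> V :=
  f (Tpow (k - 1) w).

(* [fcomp f m w] is f_0(w) f_{-1}(w) ... f_{-m}(w). *)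
Fixpoint fcomp (f : Omega -> V -> V) (m : nat) (w : Omega) : V -> V :=
  match m with
  | 0%N => fk f 0 w
  | n.+1 => fcomp f n w \o fk f (- n.+1%:Z) w
  end.

Definition Xk (X : Omega -> set V) (k : int) (w : Omega) : set V :=
  X (Tpow k w).

Definition Xcomp (f : Omega -> V -> V) (X : Omega -> set V) (m : nat)
  (w : Omega) : set V := fcomp f m w @` Xk X (- m.+1%:Z) w.

End orbit.

Definition first_index (Omega : Type) (Om : nat -> set Omega) (w : Omega) :
    nat :=
  xget 0%N [set i | Om i w /\ forall j, Om j w -> (i <= j)%N].

(* Main.v *)
Require Import Defs.
From HB Require Import structures.
From mathcomp Require Import all_boot all_order all_algebra.
From mathcomp Require Import all_classical all_reals all_analysis.
From mathcomp Require Import measurable_realfun.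
From mathcomp Require Import lra.
Import Order.TTheory GRing.Theory Num.Theory.
Import numFieldNormedType.Exports.
Local Open Scope classical_set_scope.
Local Open Scope ring_scope.

(* The sets X^(m)(w) decrease to an attractor K(w), which is non-empty and
   compact almost surely and satisfies K(Tw) = f(w, K(w)). The attractors are
   countable intersections of projections of measurable sets, hence Suslin sets,
   and Suslin sets are measurable because P is complete. So the set B_c of all w
   such that K(w) contains two points at distance > c is measurable. By (A3b),
   w in B_c implies that T^(-n) w is in B_c for all large n, and since T
   preserves P such a set is invariant up to a null set. If K(w) had diameter
   D > 0, attained by compactness, then (A3b) would give D < c < diam K(T^(-n) w)
   for some n and some rational c, contradicting the invariance of B_c. So K(w)
   is almost surely a singleton {xi(w)}, whose measurability again follows by
   projection; compactness turns the shrinking of X^(m)(w) to this point into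
   uniform convergence, and every solution eta lies in all the X^(m)(w). *)

(** * Suslin sets *)

Section suslin.
Context {E : Type}.
Implicit Types (G H : set_system E) (A : set E).

(** The Suslin operation; the scheme [r] need not decrease along extensions of [s]. *)
Definition suslin G : set_system E := [set A | exists2 r : seq nat -> set E,
  forall s, G (r s) & A = [set p | exists a, forall n, r (mkseq a n) p]].

Lemma sub_suslin G : G `<=` suslin G.
Proof.
move=> A GA; exists (fun=> A) => //; apply/seteqP; split => p /=.
  by exists id.
by move=> [a /(_ 0%N)].
Qed.

Lemma eq_mkseq (a b : nat -> nat) n :
  (forall j, (j < n)%N -> a j = b j) -> mkseq a n = mkseq b n.
Proof.
move=> ab; apply: (@eq_from_nth _ 0%N); rewrite ?size_mkseq// => i ilt.
by rewrite !nth_mkseq// ab.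
Qed.

(* The conditions [Q q] need not be indexed by initial segments: each of them
   only has to read finitely many values of the parameter. *)
Lemma suslin_param G (Q : nat -> (nat -> nat) -> set E) (k : nat -> nat) :
  G setT -> setI_closed G -> (forall q a, G (Q q a)) ->
  (forall q a b, (forall j, (j < k q)%N -> a j = b j) -> Q q a = Q q b) ->
  suslin G [set p | exists a, forall q, Q q a p].
Proof.
move=> GT GI GQ kQ.
(* [r s] intersects the finitely many conditions of index below [size s] that [s] decides; the zeros
   with which [nth 0%N s] continues [s] are never read. *)
pose r s := \big[setI/setT]_(q < size s | (k q <= size s)%N) Q q (nth 0%N s).
have rP s p : r s p <-> forall q, (q < size s)%N -> (k q <= size s)%N ->
    Q q (nth 0%N s) p.
  rewrite /r -(big_mkord (fun q => k q <= size s)%N (fun q => Q q (nth 0%N s))).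
  rewrite -big_filter.
  split => [|H].
    rewrite -bigcap_seq => + q qs kqs.
    by apply; rewrite /= mem_filter kqs mem_index_iota.
  rewrite -bigcap_seq => q /=; rewrite mem_filter mem_index_iota /= => /andP[].
  by move=> ? ?; exact: H.
exists r; first by move=> s; apply: big_ind => // q _; exact: GQ.
apply/seteqP; split => p /= [a Ha]; exists a.
  move=> n; rewrite rP size_mkseq => q qn kqn; rewrite (kQ _ _ a)// => j jk.
  by rewrite nth_mkseq// (leq_trans jk).
move=> q; have := Ha (maxn q.+1 (k q)); rewrite rP size_mkseq => /(_ q).
rewrite leq_maxl leq_maxr => /(_ isT isT); rewrite (kQ _ _ a)// => j jk.
by rewrite nth_mkseq// (leq_trans jk)// leq_maxr.
Qed.

Let dec (n : nat) : nat * nat := odflt (0, 0)%N (unpickle n).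

Let decK x : dec (pickle x) = x.
Proof. by rewrite /dec pickleK. Qed.

(** One parameter [b] can code the outer branch [al b] together with, for every [n], an inner branch
    [ga b n] for the set [r (mkseq (al b) n)]. *)
Lemma suslin_idem G : G setT -> setI_closed G ->
  suslin (suslin G) `<=` suslin G.
Proof.
move=> GT GI A [r Gr ->].
have /choice[S HS] s : exists S : seq nat -> set E, (forall t, G (S t)) /\
    r s = [set p | exists a, forall n, S (mkseq a n) p].
  by have [S GS rS] := Gr s; exists S.
pose al (b : nat -> nat) j := (dec (b j)).1.
pose ga (b : nat -> nat) (n i : nat) := (dec (b (pickle (n, i)))).2.
pose Q q b := S (mkseq (al b) (dec q).1) (mkseq (ga b (dec q).1) (dec q).2).
(* If [q] codes [(n, i)], the condition reads [b] below [n] and at the codes of [(n, j)] for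
   [j < i]. *)
pose k q := maxn (dec q).1
  (\max_(j < (dec q).2) (pickle ((dec q).1, nat_of_ord j)).+1).
suff -> : [set p | exists a, forall n, r (mkseq a n) p] =
          [set p | exists b, forall q, Q q b p].
  apply: (@suslin_param _ _ k) => //.
    by move=> q a; rewrite /Q; have [+ _] := HS (mkseq (al a) (dec q).1); apply.
  move=> q a b; rewrite /Q /k; case: (dec q) => n i /= ab.
  rewrite (@eq_mkseq (al a) (al b) n); last first.
    by move=> j jn; rewrite /al ab// leq_max jn.
  congr (S _ _); apply: eq_mkseq => j ji; rewrite /ga ab// leq_max.
  by rewrite (leq_bigmax (Ordinal ji)) ?orbT.
apply/seteqP; split => p /=.
  move=> [a Ha].
  have /choice[g Hg] n : exists g, forall i, S (mkseq a n) (mkseq g i) p.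
    by have := Ha n; have [_ ->] := HS (mkseq a n).
  exists (fun j => pickle (a j, g (dec j).1 (dec j).2)) => q; rewrite /Q.
  set b := fun j => _.
  have -> : al b = a by apply/funext => j; rewrite /al decK.
  have -> n : ga b n = g n by apply/funext => j; rewrite /ga !decK.
  exact: Hg.
move=> [b Hb]; exists (al b) => n; have [_ ->] := HS (mkseq (al b) n).
by exists (ga b n) => i; have := Hb (pickle (n, i)); rewrite /Q decK.
Qed.

Lemma suslinS G H : G `<=` H -> suslin G `<=` suslin H.
Proof. by move=> GH A [r Gr ->]; exists r => // s; exact: GH. Qed.

(** A scheme depending only on [size s] makes every branch pass through all the [A n]. *)
Lemma suslin_bigcap G (A : nat -> set E) : G setT -> setI_closed G ->
  (forall n, suslin G (A n)) -> suslin G (\bigcap_n A n).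
Proof.
move=> GT GI GA; apply: suslin_idem => //; exists (fun s => A (size s)) => //.
apply/seteqP; split => p /=.
  by move=> Ap; exists id => n; exact: Ap.
by move=> [a Ha] n _; have := Ha n; rewrite size_mkseq.
Qed.

(** The first entry of a branch selects one of the sets. *)
Lemma suslin_bigcup G (A : nat -> set E) : G setT -> setI_closed G ->
  (forall n, suslin G (A n)) -> suslin G (\bigcup_n A n).
Proof.
move=> GT GI GA; apply: suslin_idem => //.
exists (fun s => if s is n :: _ then A n else setT).
  by move=> [|n s]//; exact: sub_suslin.
apply/seteqP; split => p /=.
  by move=> [n _ Ap]; exists (fun=> n) => -[|m].
by move=> [a /(_ 1%N) Ha]; exists (a 0%N).
Qed.

Lemma suslinI G A B : G setT -> setI_closed G ->
  suslin G A -> suslin G B -> suslin G (A `&` B).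
Proof.
move=> GT GI GA GB; rewrite -bigcap2E; apply: suslin_bigcap => // n.
by rewrite /bigcap2; case: ifP => // _; case: ifP => // _; exact: sub_suslin.
Qed.

(** Suslin sets need not be stable under complement, so the induction runs over the sets that are
    Suslin together with their complements; these form a sigma-algebra. *)
Lemma sigma_suslin G H : H set0 -> H setT -> setI_closed H ->
  (forall A, G A -> suslin H A /\ suslin H (~` A)) -> <<s G >> `<=` suslin H.
Proof.
move=> H0 HT HI GH.
suff : <<s G >> `<=` [set A | suslin H A /\ suslin H (~` A)].
  by move=> sub A /sub[].
apply: smallest_sub => //; split.
- by rewrite /= setC0; split; exact: sub_suslin.
- by move=> A [HA HCA]; rewrite /= setTD setCK.
- move=> A HA; split; first by apply: suslin_bigcup => // n; have [] := HA n.
  by rewrite setC_bigcup; apply: suslin_bigcap => // n; have [] := HA n.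
Qed.

End suslin.

Lemma suslin_preimage {E E'} (G : set_system E) (G' : set_system E')
    (g : E -> E') A :
  (forall B, G' B -> G (g @^-1` B)) -> suslin G' A -> suslin G (g @^-1` A).
Proof. by move=> gG [r Gr ->]; exists (fun s => g @^-1` r s) => // s; exact/gG. Qed.

(** * Measurability of Suslin sets *)

Section sub_sigma_algebra.
Context {d} {Omega : measurableType d} {R : realType} (P : probability Omega R).
Variable G : set_system Omega.
Hypotheses (sG : sigma_algebra setT G) (Gm : forall A, G A -> measurable A).

Lemma sub_sigmaE :
  G = (measurable : set_system (g_sigma_algebraType G)).
Proof. by apply/esym; exact: sigma_algebra_id. Qed.

(** Intersecting a minimising sequence attains the least probability of a set of [G] containing [B].
    Intersecting further with [H'] gives another competitor, so no mass is lost. *)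
Lemma measurable_hull (B : set Omega) : exists2 H, G H /\ B `<=` H &
  forall H', G H' -> B `<=` H' -> P (H `\` H') = 0%E.
Proof.
pose S := [set P H | H in [set H | G H /\ B `<=` H]].
have GI (A C : set Omega) : G A -> G C -> G (A `&` C).
  by rewrite sub_sigmaE => GA GC; exact: measurableI.
have Sfin : ereal_inf S \is a fin_num.
  rewrite ge0_fin_numE; last first.
    by apply: le_ereal_inf_tmp => _ [H _ <-]; exact: measure_ge0.
  apply: (@le_lt_trans _ _ (P setT)); last by rewrite probability_setT ltry.
  apply: ereal_inf_lbound; exists setT => //; split => //.
  by rewrite sub_sigmaE; exact: measurableT.
have /choice[H HH] n : exists H, [/\ G H, B `<=` H &
    (P H < ereal_inf S + n.+1%:R^-1%:E)%E].
  have [|_ [H [GH BH] <-] lt] := @lb_ereal_inf_adherent _ S n.+1%:R^-1 _ Sfin.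
    by rewrite invr_gt0.
  by exists H.
have GH : G (\bigcap_n H n).
  rewrite sub_sigmaE; apply: bigcapT_measurable => n; rewrite -sub_sigmaE.
  by have [] := HH n.
have PH : (P (\bigcap_n H n) <= ereal_inf S)%E.
  apply/lee_addgt0Pr => e e0.
  have [n ne] : exists n, n.+1%:R^-1 < e.
    by exists (Num.truncn e^-1); rewrite invf_plt ?posrE// truncnS_gt.
  have [GHn _ /ltW lt] := HH n.
  apply: (le_trans _ (le_trans lt _)).
    by apply: le_measure; rewrite ?inE; [exact: Gm..|exact: bigcap_inf].
  by rewrite leeD2l// lee_fin ltW.
exists (\bigcap_n H n); first by split => // x Bx n _; have [_ + _] := HH n; apply.
move=> H' GH' BH'.
have mH := Gm _ GH; have mH' := Gm _ GH'.
rewrite measureD//; last by rewrite (le_lt_trans (probability_le1 _ _))// ltry.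
apply/eqP; rewrite eq_le; apply/andP; split; last first.
  rewrite -measureD ?measure_ge0//.
  by rewrite (le_lt_trans (probability_le1 _ _))// ltry.
rewrite sube_le0; apply: (le_trans PH); apply: ereal_inf_lbound.
exists (\bigcap_n H n `&` H') => //; split; first exact: GI.
by move=> x Bx; split; [move=> n _; have [_ + _] := HH n; apply|exact: BH'].
Qed.

(* Marczewski's argument: if [H s] is a hull of the part of the Suslin set
   indexed by the sequences extending [s], then a point of [H [::]] which lies
   in no [H s `\` \bigcup_n H (rcons s n)] belongs to the Suslin set. *)
Lemma suslin_complete : (forall N, P.-negligible N -> G N) -> suslin G `<=` G.
Proof.
move=> negG A [r Gr ->].
set A' := [set p | _].
pose B (s : seq nat) := [set p | exists a, mkseq a (size s) = s /\
  forall n, r (mkseq a n) p].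
have /choice[H0 HH0] s : exists H, (G H /\ B s `<=` H) /\
    forall H', G H' -> B s `<=` H' -> P (H `\` H') = 0%E.
  by have [H ? ?] := measurable_hull (B s); exists H.
(* Because of [r s], a point that stays in the sets [H] along a branch satisfies the scheme along
   it. *)
pose H s := H0 s `&` r s.
have GH s : G (H s).
  have [[+ _] _] := HH0 s; have := Gr s; rewrite sub_sigmaE.
  by move=> ? ?; exact: measurableI.
have BH s : B s `<=` H s.
  move=> p Bp; split; first by have [[_ +] _] := HH0 s; apply.
  by have [a [<- Ha]] := Bp; exact: Ha.
pose D s := H s `\` \bigcup_n H (rcons s n).
have GU s : G (\bigcup_n H (rcons s n)).
  rewrite sub_sigmaE; apply: bigcupT_measurable => n; rewrite -sub_sigmaE.
  exact: GH.
have negD s : P.-negligible (D s).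
  have [[G0 _] hull] := HH0 s.
  exists (H0 s `\` \bigcup_n H (rcons s n)); split.
  - by apply: measurableD; apply: Gm.
  (* A sequence extending [s] also extends [rcons s n] for its next entry [n], so the union covers
     [B s]. *)
  - apply: hull => // p [a [as_ Ha]]; exists (a (size s)) => //; apply: BH.
    by exists a; split => //; rewrite size_rcons mkseqS as_.
  - by move=> p [[H0p _] np].
pose u k : seq nat := odflt [::] (unpickle k).
have negA : P.-negligible (H [::] `\` A').
  apply: (@negligibleS _ _ _ _ (\bigcup_k D (u k))); last first.
    by apply: negligible_bigcup => k; exact: negD.
  move=> p [Hp nAp]; apply: contrapT => nDp; apply: nAp.
  have step s : H s p -> exists n, H (rcons s n) p.
    move=> Hsp; apply: contrapT => nH; apply: nDp; exists (pickle s) => //.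
    rewrite /u pickleK /=; split => // -[n _ Hn]; apply: nH; by exists n.
  have /choice[c Hc] s : exists n, H s p -> H (rcons s n) p.
    have [/step[n Hn]|nH] := pselect (H s p); first by exists n.
    by exists 0%N => /nH.
  pose fix t n := if n is m.+1 then rcons (t m) (c (t m)) else [::].
  have tE n : mkseq (fun n => c (t n)) n = t n.
    by elim: n => // n IH; rewrite mkseqS IH.
  have Ht n : H (t n) p by elim: n => //= n /Hc.
  by exists (fun n => c (t n)) => n; rewrite tE; have [] := Ht n.
have -> : A' = H [::] `\` (H [::] `\` A').
  rewrite setDD setIC; apply/esym/setIidPl => p [a Ha].
  by apply: BH; exists a.
by have := negG _ negA; have := GH [::]; rewrite sub_sigmaE;
  move=> ? ?; exact: measurableD.
Qed.

End sub_sigma_algebra.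

(** * Projections along a standard space *)

Section metric_space.
Context {R : realType} {M : metricType R}.

Lemma metric_ball_open (x : M) e : open (ball x e).
Proof.
rewrite openE => y; rewrite ballEmdist /= => xy; apply/nbhs_ballP.
exists (e - mdist x y) => /=; first by rewrite subr_gt0.
move=> z; rewrite !ballEmdist /= ltrBrDl; apply: le_lt_trans.
exact: metric_triangle.
Qed.

(** An open set is the countable union of the closed sets of points at distance at least [1/(n+1)]
    from its complement. *)
Lemma closed_suslin_borel : borel M `<=` suslin (@closed M).
Proof.
apply: sigma_suslin => [|||U oU].
- exact: closed0.
- exact: closedT.
- by move=> A B; exact: closedI.
split; last by apply: sub_suslin; exact: open_closedC.
pose C n := ~` \bigcup_(y in ~` U) ball y n.+1%:R^-1.
have -> : U = \bigcup_n C n.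
  apply/seteqP; split => [x Ux|x [n _ Cx]]; last first.
    apply: contrapT => nUx; apply: Cx; exists x => //.
    by apply: ballxx; rewrite invr_gt0.
  have /nbhs_ballP[e /= e0 eU] : nbhs x U by exact: open_nbhs_nbhs.
  exists (Num.truncn e^-1) => // -[y nUy xy]; apply: nUy; apply: eU.
  apply/ball_sym; apply: le_ball xy.
  by rewrite ltW// invf_plt ?posrE// truncnS_gt.
apply: suslin_bigcup; [exact: closedT|by move=> A B; exact: closedI|move=> n].
apply: sub_suslin; apply: open_closedC; apply: bigcup_open => y _.
exact: metric_ball_open.
Qed.

Lemma separable_seq (x0 : M) : separable_space M ->
  exists u : nat -> M, forall x e, 0 < e -> exists n, ball (u n) e x.
Proof.
move=> [D /countable_injP[g ginj] dD].
exists (fun n => xget x0 [set x | D x /\ g x = n]) => x e e0.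
have [y [xy Dy]] := dD (ball x e) (ex_intro _ x (ballxx x e0)) (metric_ball_open x e).
exists (g y); suff -> : xget x0 [set z | D z /\ g z = g y] = y by exact/ball_sym.
by apply: xget_unique => // z [Dz zy]; apply: ginj; rewrite ?inE.
Qed.

Lemma complete_seq (y : nat -> M) : complete_space M ->
  (forall e, 0 < e -> exists c, \forall n \near \oo, ball c e (y n)) ->
  exists x : M, y @ \oo --> x.
Proof.
move=> cM yC; apply: cM; apply/cauchy_ballP => e e0.
have [|c yc] := yC (e / 2); first by rewrite divr_gt0.
exists (ball c (e / 2), ball c (e / 2)) => //= -[a b] /= [ca cb].
by rewrite (splitr e); apply: ball_triangle cb; exact/ball_sym.
Qed.

End metric_space.

Section projection.
Context {R : realType} {d} {E : measurableType d} {dV} {V : measurableType dV}.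

(** The second side is closed in [M], so that membership survives the limits taken in
    [suslin_proj]. *)
Let rect {M : metricType R} (phi : V -> M) : set_system (E * V) :=
  [set A | exists U K, [/\ measurable U, closed K &
                         A = [set p | U p.1 /\ K (phi p.2)]]].

Let rectT {M : metricType R} (phi : V -> M) : rect phi setT.
Proof.
by exists setT, setT; split => //; apply/seteqP; split.
Qed.

Let rectI {M : metricType R} (phi : V -> M) : setI_closed (rect phi).
Proof.
move=> _ _ [U [K [mU cK ->]]] [U' [K' [mU' cK' ->]]].
exists (U `&` U'), (K `&` K'); split.
- exact: measurableI.
- exact: closedI.
- by apply/seteqP; split => p /= => [[[? ?] [? ?]]|[[? ?] [? ?]]].
Qed.

Lemma suslin_prod_measurable (M : metricType R) (phi : V -> M) :
  injective phi -> (forall A : set V, measurable A -> borel M (phi @` A)) ->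
  (measurable : set_system (E * V)) `<=` suslin (rect phi).
Proof.
move=> phi_inj phiB.
have rectU (U : set E) : measurable U -> suslin (rect phi) (fst @^-1` U).
  move=> mU; apply: sub_suslin; exists U, setT; split => //.
  by apply/seteqP; split => p //= [].
have rectV (W : set V) : measurable W -> suslin (rect phi) (snd @^-1` W).
  move=> mW.
  have -> : snd @^-1` W = (phi \o snd) @^-1` (phi @` W) :> set (E * V).
    apply/seteqP; split => p /=; first by exists p.2.
    by move=> [x Wx /phi_inj <-].
  apply: (suslin_preimage _ _ _ _ _ (closed_suslin_borel _ (phiB _ mW))) => K cK.
  by exists setT, K; split => //; apply/seteqP; split => // p [].
apply: sigma_suslin => // [|A].
  exists set0, set0; split; [exact: measurable0|exact: closed0|].
  by apply/seteqP; split => // p [].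
case=> -[W mW <-]; rewrite setTI.
  by split; [exact: rectU|exact: rectU (measurableC mW)].
by split; [exact: rectV|exact: rectV (measurableC mW)].
Qed.

(** The witness [x] is traded for a parameter [b] coding a branch for [A], a branch placing the
    point in the range of [phi], and the indices of shrinking balls around it. *)
Lemma suslin_proj (A : set (E * V)) : standard_space R V ->
  suslin measurable A -> suslin measurable [set e | exists x, A (e, x)].
Proof.
move=> [M [phi [cM sM phi_inj rphi phiB]]] sA.
have [r rr ->] : suslin (rect phi) A.
  apply: suslin_idem => //; apply: suslinS sA.
  by apply: suslin_prod_measurable => // B /phiB.
have /choice[U] := rr; move=> /choice[K rUK].
have [L Lc Lphi] := closed_suslin_borel _ rphi.
have [u uD] := separable_seq (phi point) sM.
pose dec n : nat * nat * nat := odflt (0, 0, 0)%N (unpickle n).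
pose al (b : nat -> nat) j := (dec (b j)).1.1.
pose ga (b : nat -> nat) j := (dec (b j)).1.2.
pose be (b : nat -> nat) j := (dec (b j)).2.
(* The balls have vanishing radii, so approximate solutions [y] converge by
   completeness of [M]; [L] keeps the limit in the range of [phi]. *)
pose Y b i := [set y | [/\ K (mkseq (al b) i) y, L (mkseq (ga b) i) y &
  ball (u (be b i)) i.+1%:R^-1 y]].
(* Each condition has its own witness [y], whose existence does not depend on [e]; so [Q q b] is
   either [U (mkseq (al b) q)] or empty, hence measurable. *)
pose Q q b := [set e | U (mkseq (al b) q) e /\
  exists y, forall i, (i <= q)%N -> Y b i y].
suff -> : [set e | exists x, [set p | exists a, forall n, r (mkseq a n) p] (e, x)]
    = [set e | exists b, forall q, Q q b e].
  apply: (@suslin_param _ _ _ succn) => //.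
  - by move=> *; exact: measurableI.
  - move=> q b; rewrite /Q.
    have [ex|nex] := pselect (exists y, forall i, (i <= q)%N -> Y b i y).
      have [mU _ _] := rUK (mkseq (al b) q).
      by rewrite (_ : [set e | _] = U (mkseq (al b) q))//; apply/seteqP; split => // e [].
    by rewrite (_ : [set e | _] = set0)//; apply/seteqP; split => // e [].
  - move=> q a b ab.
    have Eal i : (i <= q)%N -> mkseq (al a) i = mkseq (al b) i.
      move=> iq; apply: eq_mkseq => j ji; rewrite /al ab//.
      by rewrite ltnS (leq_trans (ltnW ji)).
    have Ega i : (i <= q)%N -> mkseq (ga a) i = mkseq (ga b) i.
      move=> iq; apply: eq_mkseq => j ji; rewrite /ga ab//.
      by rewrite ltnS (leq_trans (ltnW ji)).
    have EY i : (i <= q)%N -> Y a i = Y b i.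
      by move=> iq; rewrite /Y Eal// Ega// /be ab.
    rewrite /Q Eal//; apply/seteqP; split => e /= [Ue [y Hy]]; split => //;
      by exists y => i iq; have := Hy i iq; rewrite EY.
apply/seteqP; split => e /=.
  move=> [x [a Ha]].
  have : range phi (phi x) by exists x.
  rewrite Lphi => -[g Hg].
  have /choice[c Hc] i : exists n, ball (u n) i.+1%:R^-1 (phi x).
    by apply: uD; rewrite invr_gt0.
  exists (fun j => pickle (a j, g j, c j)) => q.
  set b := fun j => _.
  have alE : al b = a by apply/funext => j; rewrite /al /dec pickleK.
  have gaE : ga b = g by apply/funext => j; rewrite /ga /dec pickleK.
  have beE : be b = c by apply/funext => j; rewrite /be /dec pickleK.
  have HaE i : U (mkseq a i) e /\ K (mkseq a i) (phi x).
    by have := Ha i; have [_ _ ->] := rUK (mkseq a i).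
  split; first by rewrite alE; have [] := HaE q.
  exists (phi x) => i _; rewrite /Y /= alE gaE beE; split => //.
  by have [] := HaE i.
move=> [b Hb].
have /choice[y Hy] q : exists y, forall i, (i <= q)%N -> Y b i y.
  by have [] := Hb q.
have [z yz] : exists z : M, y @ \oo --> z.
  apply: complete_seq => // e0 e0_gt0.
  exists (u (be b (Num.truncn e0^-1))).
  near=> n; have [|_ _] := Hy n (Num.truncn e0^-1).
    by near: n; exact: nbhs_infty_ge.
  by apply: le_ball; rewrite ltW// invf_plt ?posrE// truncnS_gt.
have [x _ xz] : range phi z.
  rewrite Lphi; exists (ga b) => n.
  apply: (@closed_cvg _ _ \oo _ y _ (Lc (mkseq (ga b) n)) _ _ yz); near=> m.
  by have [|_ + _] := Hy m n; first by near: m; exact: nbhs_infty_ge.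
exists x, (al b) => n; have [_ cK ->] := rUK (mkseq (al b) n).
split => /=; first by have [] := Hb n.
rewrite xz; apply: (@closed_cvg _ _ \oo _ y _ cK _ _ yz); near=> m.
by have [|+ _ _] := Hy m n; first by near: m; exact: nbhs_infty_ge.
Unshelve. all: by end_near.
Qed.

End projection.

(** * Compactness and recurrence *)

Section compactness.
Context {R : realType} {M : metricType R}.

Lemma compact_bigcap_neq0 (C : nat -> set M) : (forall n, compact (C n)) ->
  (forall n, C n.+1 `<=` C n) -> (forall n, C n !=set0) ->
  \bigcap_n C n !=set0.
Proof.
move=> cC dC /choice[x Cx].
have dec m n : (m <= n)%N -> C n `<=` C m.
  elim: n => [|n IH]; first by rewrite leqn0 => /eqP->.
  rewrite leq_eqVlt => /orP[/eqP->//|]; rewrite ltnS => /IH.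
  exact: subset_trans (dC n).
have [p [_ px]] : exists p, (C 0%N `&` cluster (x @ \oo)) p.
  apply: (cC 0%N (x @ \oo)); exists 0%N => // n _.
  exact: (dec 0%N n (leq0n n) _ (Cx n)).
exists p => n _; apply: (compact_closed (@metric_hausdorff _ _) (cC n)).
move=> B Bp; apply: (px (C n) B) => //; exists n => // m nm.
exact: (dec n m nm _ (Cx m)).
Qed.

Lemma continuous_mdist : continuous (fun p : M * M => mdist p.1 p.2).
Proof.
move=> [a b]; apply/cvgrPdist_lt => e e0 /=.
have e2 : 0 < e / 2 by rewrite divr_gt0.
exists (ball a (e / 2), ball b (e / 2)).
  by split; exact: nbhsx_ballx.
move=> [x y] [/=]; rewrite !ballEmdist /= => ax bY.
have := metric_triangle a x b; have := metric_triangle x y b.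
have := metric_triangle x a y; have := metric_triangle a b y.
rewrite (metric_sym y b) (metric_sym x a) => t1 t2 t3 t4.
by rewrite ltr_norml; apply/andP; split; lra.
Qed.

Lemma compact_max_mdist (K : set M) : K !=set0 -> compact K ->
  exists x y, [/\ K x, K y & forall x' y', K x' -> K y' ->
    mdist x' y' <= mdist x y].
Proof.
move=> [k Kk] cK.
have [||[x y] /set_mem[/= Kx Ky] xy] :=
    @compact_EVT_max _ R (fun p : M * M => mdist p.1 p.2) (K `*` K) _
      (compact_setX cK cK).
- by exists (k, k).
- by apply: continuous_subspaceT; exact: continuous_mdist.
exists x, y; split => // x' y' Kx' Ky'.
by apply: (xy (x', y')); rewrite inE.
Qed.

End compactness.

Section measure_preserving.
Context {d} {Omega : measurableType d} {R : realType} (P : probability Omega R).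
Variable S : Omega -> Omega.
Hypotheses (mS : measurable_fun setT S)
  (PS : forall A, measurable A -> P (S @^-1` A) = P A).

Let mSn n : measurable_fun setT (iter n S).
Proof.
elim: n => [|n IH]; first exact: measurable_id.
exact: (measurableT_comp mS IH).
Qed.

Let PSn n A : measurable A -> P (iter n S @^-1` A) = P A.
Proof.
move=> mA; elim: n => // n IH; rewrite -IH -[RHS]PS; last first.
    by rewrite -[X in measurable X]setTI; exact: mSn.
by congr (P _); apply/seteqP; split => w /=; rewrite -iterS iterSr.
Qed.

Lemma ae_iter (Q : Omega -> Prop) : {ae P, forall w, Q w} ->
  {ae P, forall w, forall n, Q (iter n S w)}.
Proof.
move=> [N [mN PN QN]]; apply: ae_foralln => n.
exists (iter n S @^-1` N); split.
- by rewrite -[X in measurable X]setTI; exact: mSn.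
- by move: (PSn n _ mN); rewrite PN.
- by move=> w nQ; apply: QN.
Qed.

(* The set of points whose orbit eventually stays in [B] is invariant,
   contains [B] up to a null set, and has measure at most [P B]. *)
Lemma ae_eventually_invariant (B : set Omega) : measurable B ->
  {ae P, forall w, B w -> exists N, forall n, (N <= n)%N -> B (iter n S w)} ->
  {ae P, forall w, forall n, B (iter n S w) -> B w}.
Proof.
move=> mB Bev.
pose E N := \bigcap_n iter (N + n) S @^-1` B.
have mE N : measurable (E N).
  apply: bigcapT_measurable => n; rewrite -[X in measurable X]setTI.
  exact: mSn.
have mU : measurable (\bigcup_N E N) by exact: bigcupT_measurable.
(* [E N] increases with [N] and lies in the preimage of [B] under the [N]-th iterate, which has
   measure [P B]. *)
have PU : (P (\bigcup_N E N) <= P B)%E.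
  have := @nondecreasing_cvg_mu _ _ _ P E mE mU.
  have ndE : {homo E : n m / (n <= m)%N >-> (n <= m)%O}.
    move=> n m nm; apply/subsetPset => w Ew k _.
    by have := Ew (m - n + k)%N I; rewrite addnA subnKC.
  move=> /(_ ndE) cvgE; rewrite -(cvg_lim _ cvgE)//.
  apply: lime_le; first exact: cvgP cvgE.
  apply: nearW => N /=; rewrite -[leRHS](PSn N)//; apply: le_measure; rewrite ?inE//.
    by rewrite -[X in measurable X]setTI; exact: mSn.
  by move=> w /(_ 0%N I); rewrite addn0.
have nUB : P.-negligible (\bigcup_N E N `\` B).
  exists (\bigcup_N E N `\` B); split => //; first exact: measurableD.
  have PUfin : (P (\bigcup_N E N) < +oo)%E.
    by rewrite (le_lt_trans (probability_le1 _ _))// ltry.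
  (* By [Bev], almost all of [B] lies in the union; with [PU], no mass is left for the union outside
     [B]. *)
  have BU : (P B <= P (\bigcup_N E N `&` B))%E.
    rewrite (measureDI P mB mU) setIC.
    rewrite (measure_negligible (measurableD mB mU)) ?add0e//.
    apply: negligibleS Bev => w /= [Bw nEw] /(_ Bw)[N HN]; apply: nEw.
    by exists N => // n _; apply: HN; exact: leq_addr.
  apply/eqP; rewrite eq_le measure_ge0 andbT measureD//.
  by rewrite sube_le0; exact: le_trans BU.
have : {ae P, forall w, ~ (\bigcup_N E N `\` B) w}.
  by apply: negligibleS nUB => w /= /contrapT.
move=> nUB'; move: (ae_iter _ Bev); apply: filterS2 nUB' => w nw Hw n Bn.
have [N HN] := Hw n Bn.
apply: contrapT => nB; apply: nw; split => //.
exists (N + n)%N => // k _ /=; have := HN (N + k)%N (leq_addr _ _).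
by rewrite -iterD addnAC.
Qed.

End measure_preserving.

(** * The attractor *)

Section attractor.
Context {Omega V : Type} {T Tinv : Omega -> Omega} {f : Omega -> V -> V}
  {X : Omega -> set V}.
Hypotheses (TK : cancel T Tinv) (TinvK : cancel Tinv T)
  (hf : forall w x, X w x -> X (T w) (f w x)).
Implicit Types (w : Omega) (m n : nat).

Lemma fk_neg n w : fk T Tinv f (- n%:Z) w = f (iter n.+1 Tinv w).
Proof. by case: n => [|n]//; rewrite /fk -[LHS]/(f (iter (n + 0).+2 Tinv w)) addn0. Qed.

(** [fcomp] recurses on its innermost factor. Peeling off the outermost one instead moves the base
    point to [Tinv w], as inductions along the orbit require. *)
Lemma fcompSl m w x :
  fcomp T Tinv f m.+1 w x = f (Tinv w) (fcomp T Tinv f m (Tinv w) x).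
Proof.
elim: m x => [//|m IH] x.
rewrite -[LHS]/(fcomp T Tinv f m.+1 w (fk T Tinv f (- m.+2%:Z) w x)) IH.
by rewrite fk_neg iterSr -fk_neg.
Qed.

Lemma XcompS m w : Xcomp T Tinv f X m.+1 w =
  f (Tinv w) @` Xcomp T Tinv f X m (Tinv w).
Proof.
apply/seteqP; split => y /=.
  move=> [x Xx <-]; rewrite fcompSl; eexists => //; exists x => //.
  by move: Xx; rewrite /Xk [Tpow _ _ _ _]iterSr.
move=> [_ [x Xx <-] <-]; exists x; last exact: fcompSl.
by rewrite /Xk [Tpow _ _ _ _]iterSr.
Qed.

Lemma Xcomp_sub m w : Xcomp T Tinv f X m.+1 w `<=` Xcomp T Tinv f X m w.
Proof.
move=> _ [x Xx <-]; exists (fk T Tinv f (- m.+1%:Z) w x) => //.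
by rewrite fk_neg; have := hf _ _ Xx; rewrite [X in X _ _ -> _]/= TinvK.
Qed.

Lemma Xcomp_homo m n w : (m <= n)%N ->
  Xcomp T Tinv f X n w `<=` Xcomp T Tinv f X m w.
Proof.
elim: n => [|n IH]; first by rewrite leqn0 => /eqP->.
rewrite leq_eqVlt => /orP[/eqP->//|]; rewrite ltnS => /IH.
exact: subset_trans (Xcomp_sub n w).
Qed.

Lemma Xcomp_X m w : Xcomp T Tinv f X m w `<=` X w.
Proof.
apply: subset_trans (Xcomp_homo _ _ w (leq0n m)) _ => _ [x Xx <-].
by have := hf _ _ Xx; rewrite /= TinvK.
Qed.

Lemma Xcomp_neq0 m w : (forall w, X w !=set0) -> Xcomp T Tinv f X m w !=set0.
Proof. by move=> X0; have [x Xx] := X0 (iter m.+1 Tinv w); eexists; exists x. Qed.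

(** The pullback attractor: the base point is fixed and the starting time recedes into the past. *)
Definition attractor w : set V := \bigcap_m Xcomp T Tinv f X m w.

Lemma attractor_image w x : attractor w x -> attractor (T w) (f w x).
Proof.
move=> Kx m _; apply: Xcomp_sub; rewrite XcompS TK; exists x => //.
exact: Kx.
Qed.

(** Following the equation backwards, [eta w] is the image under [fcomp] of the value of [eta] at
    each earlier point of the orbit. *)
Lemma attractor_orbit (eta : Omega -> V) w : (forall w, X w (eta w)) ->
  (forall n, eta (T (iter n Tinv w)) = f (iter n Tinv w) (eta (iter n Tinv w))) ->
  attractor w (eta w).
Proof.
move=> Xeta etaE m _; elim: m w etaE => [|m IH] w etaE.
  exists (eta (Tinv w)); first exact: Xeta.
  by have := etaE 1%N; rewrite /= TinvK => ->.
rewrite XcompS; exists (eta (Tinv w)).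
  by apply: IH => n; have := etaE n.+1; rewrite iterSr.
by have := etaE 1%N; rewrite /= TinvK => ->.
Qed.

End attractor.
Arguments attractor {Omega V} T Tinv f X w.

Section compact_attractor.
Context {R : realType} {Omega : Type} {V : choiceType} {T Tinv : Omega -> Omega}
  {f : Omega -> V -> V} {X Y : Omega -> set V}
  {rho : forall w, metric_on R (Y w)}.
Hypotheses (TK : cancel T Tinv) (TinvK : cancel Tinv T)
  (hf : forall w x, X w x -> X (T w) (f w x))
  (X0 : forall w, X w !=set0)
  (fY : forall w x, Y w x -> Y (T w) (f w x))
  (fcont : forall w, continuous (metric_sub_map (rho w) (rho (T w)) (fY w))).
Implicit Types (w : Omega) (m n : nat).

Local Notation XX := (Xcomp T Tinv f X).
Local Notation K := (attractor T Tinv f X).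

(** Only a tail is asked for, since a point may enter the sets [Om m] late. *)
Definition eventually_compact w := exists N, forall m, (N <= m)%N ->
  XX m w `<=` Y w /\ compact (sub_val (rho w) @^-1` XX m w).

Definition sub_point {w} x (Yx : Y w x) : metric_sub (rho w) :=
  exist _ x (mem_set Yx).

(** Cantor's intersection theorem for the traces of [C] on the compact tail. Non-emptiness, lifting
    and uniform convergence are all obtained from it by choosing [C]. *)
Lemma attractor_meets w (C : set (metric_sub (rho w))) :
  eventually_compact w -> closed C ->
  (forall m, exists2 x, C x & XX m w (sub_val (rho w) x)) ->
  exists2 x, C x & K w (sub_val (rho w) x).
Proof.
move=> [N HN] cC XC.
have [|n|n|x Hx] := @compact_bigcap_neq0 R _
    (fun n => sub_val (rho w) @^-1` XX (N + n)%N w `&` C).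
- move=> n; apply: compact_closedI => //.
  by have [] := HN (N + n)%N (leq_addr _ _).
- by move=> x [Xx Cx]; split => //; move: Xx; rewrite addnS; exact: Xcomp_sub.
- by have [x Cx Xx] := XC (N + n)%N; exists x.
exists x; first by have [] := Hx 0%N I.
move=> m _; apply: (@Xcomp_homo _ _ _ _ _ _ TinvK hf _ (N + m)%N).
  exact: leq_addl.
by have [] := Hx m I.
Qed.

Lemma attractorY w : eventually_compact w -> K w `<=` Y w.
Proof. by move=> [N HN] x Kx; have [+ _] := HN N (leqnn N); apply; exact: Kx. Qed.

(** For small [m] a point of [XX m w] may lie outside [Y w]; taking it from a later, smaller set
    avoids this. *)
Lemma eventually_meets w (C : set V) : eventually_compact w ->
  (forall m, XX m w `&` C !=set0) ->
  forall m, exists2 x, (sub_val (rho w) @^-1` C) x & XX m w (sub_val (rho w) x).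
Proof.
move=> [N HN] XC m; have [x [Xx Cx]] := XC (N + m)%N.
have [XY _] := HN (N + m)%N (leq_addr _ _).
exists (sub_point x (XY _ Xx)) => //.
by apply: (@Xcomp_homo _ _ _ _ _ _ TinvK hf _ (N + m)%N) => //; exact: leq_addl.
Qed.

Lemma attractor_neq0 w : eventually_compact w -> K w !=set0.
Proof.
move=> cw; have [m|x _ Kx] := @attractor_meets w setT cw closedT; last first.
  by exists (sub_val (rho w) x).
have [n|x _ Xx] := eventually_meets w setT cw _ m; last by exists x.
by have [x Xx] := Xcomp_neq0 n w X0 : XX n w !=set0; exists x.
Qed.

(** The fibre of [f w] over [y] is closed in [Y w] by continuity and meets every [XX m w], because
    [y] is in [XX m.+1 (T w)]. *)
Lemma attractor_lift w y : eventually_compact w -> K (T w) y ->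
  exists2 x, K w x & f w x = y.
Proof.
move=> cw Ky.
have XXy m : XX m w `&` [set x | f w x = y] !=set0.
  by have := Ky m.+1 I; rewrite XcompS TK => -[x Xx fx]; exists x.
have XYy := eventually_meets w _ cw XXy.
(* [F x0] is [y] as a point of the metric space on [Y (T w)]. *)
have [x0 fx0 _] := XYy 0%N.
pose F := metric_sub_map (rho w) (rho (T w)) (fY w).
have [||x Fx Kx] := @attractor_meets w (F @^-1` [set F x0]) cw.
- apply: preimage_closed => [x _|]; first exact: fcont.
  exact/accessible_closed_set1/hausdorff_accessible/metric_hausdorff.
- by move=> m; have [x fx Xx] := XYy m; exists x => //; apply: val_inj => /=;
    rewrite fx.
exists (sub_val (rho w) x) => //.
exact: etrans (congr1 (sub_val (rho (T w))) Fx) fx0.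
Qed.

Lemma attractor_fcomp m w y : (forall n, eventually_compact (iter n Tinv w)) ->
  K w y -> exists2 x, K (iter m.+1 Tinv w) x & fcomp T Tinv f m w x = y.
Proof.
elim: m w y => [|m IH] w y cw Ky; have [|x Kx fx] := @attractor_lift (Tinv w) y (cw 1%N).
- by rewrite TinvK.
- by exists x.
- by rewrite TinvK.
have [|z Kz zx] := IH (Tinv w) x _ Kx.
  by move=> n; rewrite -iterSr; exact: cw.
by exists z; [rewrite iterSr|rewrite fcompSl zx].
Qed.

Lemma attractor_max w : eventually_compact w -> exists x y, [/\ K w x, K w y &
  forall x' y', K w x' -> K w y' -> rho w x' y' <= rho w x y].
Proof.
move=> cw; have [N HN] := cw; have [XY cX] := HN N (leqnn N).
have [z Kz] := attractor_neq0 w cw.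
have [||x [y [Kx Ky xy]]] := @compact_max_mdist R (metric_sub (rho w))
    (sub_val (rho w) @^-1` K w).
- by exists (sub_point z (attractorY w cw z Kz)).
- apply: subclosed_compact cX _; last by move=> x /(_ N I).
  (* Only the sets of the tail are known to be closed. *)
  rewrite (_ : _ @^-1` _ = \bigcap_m (sub_val (rho w) @^-1` XX (N + m)%N w)).
    apply: closed_bigI => m _; apply: compact_closed; first exact: metric_hausdorff.
    by have [] := HN (N + m)%N (leq_addr _ _).
  apply/seteqP; split => x Kx m _; first exact: Kx.
  apply: (@Xcomp_homo _ _ _ _ _ _ TinvK hf _ (N + m)%N); first exact: leq_addl.
  exact: Kx.
exists (sub_val (rho w) x), (sub_val (rho w) y); split => // x' y' Kx' Ky'.
exact: (xy (sub_point x' (attractorY w cw x' Kx'))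
  (sub_point y' (attractorY w cw y' Ky'))).
Qed.

(** Otherwise the complement of some ball around [xi] would meet every [XX m w], hence also the
    attractor. *)
Lemma attractor_sup_cvg w xi : eventually_compact w -> K w = [set xi] ->
  ereal_sup [set (rho w xi x)%:E | x in XX m w] @[m --> \oo] --> 0%E.
Proof.
move=> cw Kxi.
have Yxi : Y w xi by apply: attractorY => //; rewrite Kxi.
have small e : 0 < e -> \forall m \near \oo, forall x, XX m w x -> rho w xi x < e.
  move=> e0; apply: contrapT => nsmall.
  have XC m : XX m w `&` [set x | e <= rho w xi x] !=set0.
    apply: contrapT => nXC; apply: nsmall; exists m => // n mn x Xx.
    rewrite ltNge; apply/negP => ex; apply: nXC; exists x; split => //.
    exact: (Xcomp_homo TinvK hf m n w mn _ Xx).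
  have [||x xix Kx] := @attractor_meets w
      (~` ball (sub_point xi Yxi : metric_sub (rho w)) e) cw.
  - exact/open_closedC/metric_ball_open.
  - move=> m; have [x ex Xx] := eventually_meets w _ cw XC m.
    by exists x => //; rewrite ballEmdist /= => /lt_geF; rewrite ex.
  apply: xix; rewrite ballEmdist /=.
  move: Kx; rewrite Kxi => /= Kx; rewrite /mdist /= /sub_dist Kx.
  by rewrite mdist_onxx.
have XY : \forall m \near \oo, XX m w `<=` Y w.
  by have [N HN] := cw; exists N => // m /HN[].
(* A supremum over the empty set would be [-oo], and [rho w] may be negative outside [Y w]: both are
   excluded for large [m]. *)
have ge0 : \forall m \near \oo,
    (0 <= ereal_sup [set (rho w xi x)%:E | x in XX m w])%E.
  near=> m; have [x Xx] := Xcomp_neq0 m w X0 : XX m w !=set0.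
  have XYm : XX m w `<=` Y w by near: m; exact: XY.
  have Yx := XYm _ Xx.
  have := @mdist_ge0 _ _ (sub_point xi Yxi : metric_sub (rho w)) (sub_point x Yx).
  rewrite -lee_fin => /le_trans; apply; apply: ereal_sup_ubound.
  by exists x.
apply/fine_cvgP; split.
  near=> m; rewrite ge0_fin_numE; last by near: m.
  apply: (@le_lt_trans _ _ 1%:E); last exact: ltry.
  apply: ge_ereal_sup => _ [x Xx <-]; rewrite lee_fin ltW//.
  by move: x Xx; near: m; exact: small.
apply/cvgrPdist_le => e e0; near=> m.
rewrite sub0r normrN /= ger0_norm; last by rewrite fine_ge0//; near: m.
have ge0m : (0 <= ereal_sup [set (rho w xi x)%:E | x in XX m w])%E by near: m.
have le_e : (ereal_sup [set (rho w xi x)%:E | x in XX m w] <= e%:E)%E.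
  apply: ge_ereal_sup => _ [x Xx <-]; rewrite lee_fin ltW//.
  by move: x Xx; near: m; exact: small.
by rewrite -lee_fin fineK// ge0_fin_numE// (le_lt_trans le_e)// ltry.
Unshelve. all: by end_near.
Qed.

End compact_attractor.

(** * Measurability of the attractor *)

Section measurability.
Context {R : realType} {d} {E : measurableType d} {dV} {V : measurableType dV}.
Hypothesis hV : standard_space R V.

(** Pull back the balls of radius [1/(k+1)] around a dense sequence: one that contains [phi x] and
    has radius below half the distance misses [phi y]. *)
Lemma standard_separating : exists W : nat -> set V,
  (forall n, measurable (W n)) /\
  (forall x y, (forall n, W n x -> W n y) -> x = y).
Proof.
have [M [phi [cM sM phi_inj rphi phiB]]] := hV.
have [u uD] := separable_seq (phi point) sM.
pose dec n : nat * nat := odflt (0, 0)%N (unpickle n).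
exists (fun n => phi @^-1` ball (u (dec n).1) (dec n).2.+1%:R^-1); split.
  move=> n; apply/phiB; set B := ball _ _.
  have -> : phi @` (phi @^-1` B) = range phi `&` B.
    apply/seteqP; split => [_ [x Bx <-]|_ [[x _ <-] Bx]]; last by exists x.
    by split => //; exists x.
  have bB : borel M B by apply: sub_gen_smallest; exact: metric_ball_open.
  have /sigma_algebraP[//|_ _ _ borelI] := smallest_sigma_algebra setT (@open M).
  exact: borelI.
move=> x y Wxy; apply: phi_inj; apply: contrapT => /eqP.
rewrite -mdist_gt0 => xy.
have [k ke] : exists k, k.+1%:R^-1 < mdist (phi x) (phi y) / 2.
  exists (Num.truncn (mdist (phi x) (phi y) / 2)^-1).
  by rewrite invf_plt ?posrE ?divr_gt0// truncnS_gt.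
have [n nx] : exists n, ball (u n) k.+1%:R^-1 (phi x).
  by apply: uD; rewrite invr_gt0.
have := Wxy (pickle (n, k)); rewrite /dec pickleK /= => /(_ nx) ny.
move: nx ny; rewrite !ballEmdist /= => nx ny.
have := metric_triangle (phi x) (u n) (phi y); rewrite (metric_sym (phi x) (u n)).
move: ke nx ny; move: (_ %:R^-1) (mdist _ _) (mdist _ _) (mdist _ _) => e a b c.
by lra.
Qed.

Lemma add_inftyP (B : set (add_infty V)) :
  measurable (@Some V @^-1` B) -> measurable B.
Proof.
by move=> mB; apply: sub_gen_smallest; rewrite /image_set_system /= setTI.
Qed.

(** Two points differ exactly when some [W n] contains the first and not the second, so the
    complement is a countable union of rectangles. *)
Lemma measurable_eq_Some :
  measurable [set p : add_infty V * V | p.1 = Some p.2].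
Proof.
have [W [mW Winj]] := standard_separating.
pose N : set (add_infty V * V) := fst @^-1` [set None : add_infty V].
pose D n : set (add_infty V * V) :=
  (fst @^-1` (@Some V @` W n : set (add_infty V))) `&` (snd @^-1` (~` W n)).
have -> : [set p : add_infty V * V | p.1 = Some p.2] =
    ~` (N `|` \bigcup_n D n).
  apply/seteqP; split => [[a y] /= -> [//|[n _ [[z Wz [<-]]]]]//|].
  move=> [[x|] y] nND; last by exfalso; apply: nND; left.
  congr Some; apply: Winj => n Wx; apply: contrapT => nWy.
  by apply: nND; right; exists n => //; split => //; exists x.
apply: measurableC; apply: measurableU.
  rewrite -[X in measurable X]setTI; apply: measurable_fst => //.
  apply: add_inftyP; rewrite (_ : _ @^-1` _ = set0)//.
  by apply/seteqP; split.
apply: bigcupT_measurable => n; apply: measurableI.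
  rewrite -[X in measurable X]setTI; apply: measurable_fst => //.
  apply: add_inftyP; rewrite (_ : _ @^-1` _ = W n)//.
  by apply/seteqP; split => x /=; [move=> [z Wz [<-]]|exists x].
rewrite -[X in measurable X]setTI; apply: measurable_snd => //.
exact: measurableC.
Qed.

Lemma suslin_measurableI (A B : set E) :
  suslin measurable A -> suslin measurable B -> suslin measurable (A `&` B).
Proof. by apply: suslinI => // *; exact: measurableI. Qed.

End measurability.

Section image.
Context {R : realType} {d} {E : measurableType d} {dV} {V : measurableType dV}.
Hypothesis hV : standard_space R V.

(** The image is the projection, along [z], of a Suslin set of triples [(w, y, z)]. *)
Lemma suslin_image (h : E * V -> add_infty V) (A : set (E * V)) :
  measurable_fun setT h -> suslin measurable A ->
  suslin measurable
    [set p : E * V | exists2 z, A (p.1, z) & h (p.1, z) = Some p.2].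
Proof.
move=> mh sA.
pose g (q : E * V * V) : E * V := (q.1.1, q.2).
have mg : measurable_fun setT g.
  apply: measurable_fun_pair => //.
  exact: (measurableT_comp measurable_fst measurable_fst).
pose k (q : E * V * V) : add_infty V * V := (h (g q), q.1.2).
have mk : measurable_fun setT k.
  apply: measurable_fun_pair; first exact: (measurableT_comp mh mg).
  exact: (measurableT_comp measurable_snd measurable_fst).
have := @suslin_proj R _ (E * V)%type _ V
  (g @^-1` A `&` k @^-1` [set p | p.1 = Some p.2]) hV.
rewrite (_ : [set e | _] =
    [set p : E * V | exists2 z, A (p.1, z) & h (p.1, z) = Some p.2]).
  apply; apply: suslin_measurableI.
    apply: suslin_preimage sA => B mB.
    by rewrite -[X in measurable X]setTI; exact: mg.
  apply: sub_suslin; rewrite -[X in measurable X]setTI; apply: mk => //.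
  exact: (measurable_eq_Some hV).
by apply/seteqP; split => p /= [z]; [move=> [? ?]|move=> ? ?]; exists z.
Qed.

End image.

Section attractor_measurability.
Context {R : realType} {d} {Omega : measurableType d} {dV} {V : measurableType dV}
  {T Tinv : Omega -> Omega} {f : Omega -> V -> V} {X : Omega -> set V}
  {F0 F1 : set_system Omega}.
Hypotheses (hV : standard_space R V)
  (TinvK : cancel Tinv T)
  (hf : forall w x, X w x -> X (T w) (f w x))
  (mT01 : measurable_fun setT
    (Tinv : g_sigma_algebraType F0 -> g_sigma_algebraType F1))
  (mT00 : measurable_fun setT
    (Tinv : g_sigma_algebraType F0 -> g_sigma_algebraType F0))
  (mf : measurable_fun setT
    (fbar X f : g_sigma_algebraType F1 * V -> add_infty V)).

Local Notation E0 := (g_sigma_algebraType F0).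
Local Notation E1 := (g_sigma_algebraType F1).
Local Notation K := (attractor T Tinv f X).

Lemma fbar_Some w x y : fbar X f (w, x) = Some y <-> X w x /\ f w x = y.
Proof.
rewrite /fbar /=; case: ifPn => [/set_mem Xx|/negP nX]; last first.
  by split => // -[Xx _]; exfalso; apply: nX; exact: mem_set.
by split => [[<-]|[_ ->]].
Qed.

(** By [XcompS] each step is a fibrewise image under [f (Tinv w)]. The shift by [Tinv] turns the
    [F1]-measurability of [fbar] into [F0]-measurability. *)
Lemma Xcomp_suslin m :
  suslin measurable [set p : E0 * V | Xcomp T Tinv f X m p.1 p.2].
Proof.
pose S0 (p : E0 * V) : E0 * V := (Tinv p.1, p.2).
pose S1 (p : E0 * V) : E1 * V := (Tinv p.1, p.2).
have mS0 : measurable_fun setT S0.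
  by apply: measurable_fun_pair => //; exact: (measurableT_comp mT00 measurable_fst).
have mS1 : measurable_fun setT S1.
  by apply: measurable_fun_pair => //; exact: (measurableT_comp mT01 measurable_fst).
have mh : measurable_fun setT (fbar X f \o S1 : E0 * V -> add_infty V).
  exact: (measurableT_comp mf mS1).
elim: m => [|m IH].
  (* The whole product can serve as domain, since [fbar] takes a value [Some y] only on [X]. *)
  have := suslin_image hV _ _ mh (sub_suslin _ _ measurableT).
  congr (suslin _ _); apply/seteqP; split => -[w y] /=.
    by move=> [x _ /fbar_Some[Xx fx]]; exists x.
  by move=> [x Xx fx]; exists x => //; apply/fbar_Some.
have sA : suslin measurable (S0 @^-1` [set p : E0 * V | Xcomp T Tinv f X m p.1 p.2]).
  apply: suslin_preimage IH => B mB.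
  by rewrite -[X in measurable X]setTI; exact: mS0.
have := suslin_image hV _ _ mh sA.
congr (suslin _ _); apply/seteqP; split => -[w y] /=; rewrite XcompS//.
  by move=> [x Xx /fbar_Some[_ fx]]; exists x.
move=> [x Xx fx]; exists x => //; apply/fbar_Some; split => //.
exact: (Xcomp_X TinvK hf) Xx.
Qed.

Lemma attractor_suslin : suslin measurable [set p : E0 * V | K p.1 p.2].
Proof.
rewrite (_ : mkset _ =
    \bigcap_m [set p : E0 * V | Xcomp T Tinv f X m p.1 p.2])//.
by apply: suslin_bigcap => // [*|]; [exact: measurableI|exact: Xcomp_suslin].
Qed.

Lemma attractor_hit_suslin (B : set V) : measurable B ->
  suslin measurable [set w : E0 | exists x, K w x /\ B x].
Proof.
move=> mB; apply: (suslin_proj ([set p : E0 * V | K p.1 p.2] `&` snd @^-1` B) hV).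
apply: suslin_measurableI; first exact: attractor_suslin.
by apply: sub_suslin; rewrite -[X in measurable X]setTI; exact: measurable_snd.
Qed.

Lemma attractor_diameter_suslin (g : E0 * V * V -> \bar R) (D : set (\bar R)) :
  measurable_fun setT g -> measurable D ->
  suslin measurable
    [set w : E0 | exists x y, [/\ K w x, K w y & D (g (w, x, y))]].
Proof.
move=> mg mD.
pose g1 (q : E0 * V * V) : E0 * V := (q.1.1, q.2).
have mg1 : measurable_fun setT g1.
  apply: measurable_fun_pair => //.
  exact: (measurableT_comp measurable_fst measurable_fst).
have sA : suslin measurable (fst @^-1` [set p : E0 * V | K p.1 p.2] `&`
    g1 @^-1` [set p : E0 * V | K p.1 p.2] `&` g @^-1` D).
  apply: suslin_measurableI; last first.
    by apply: sub_suslin; rewrite -[X in measurable X]setTI; exact: mg.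
  apply: suslin_measurableI; apply: suslin_preimage attractor_suslin => B mB.
    by rewrite -[X in measurable X]setTI; exact: measurable_fst.
  by rewrite -[X in measurable X]setTI; exact: mg1.
have := suslin_proj _ hV (suslin_proj _ hV sA).
congr (suslin _ _); apply/seteqP; split => w /=.
  by move=> [x [y [[? ?] ?]]]; exists x, y.
by move=> [x [y [? ? ?]]]; exists x, y.
Qed.

End attractor_measurability.

(** * The random fixed point *)

Lemma metric_on_ge0 {R : realType} {V : choiceType} {Y : set V}
  (rho : metric_on R Y) x y : Y x -> Y y -> 0 <= rho x y.
Proof.
move=> Yx Yy; have := mdist_on_triangle rho Yx Yy Yx.
by rewrite mdist_onxx// (mdist_on_sym rho Yy Yx) -mulr2n pmulrn_lge0.
Qed.

Theorem theorem3 (R : realType)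
  (d : measure_display) (Omega : measurableType d) (P : probability Omega R)
  (hP : measure_is_complete P)
  (T Tinv : Omega -> Omega) (hT : automorphism P T Tinv)
  (F : int -> set_system Omega) (hF : invariant_filtration P T F)
  (dV : measure_display) (V : measurableType dV) (hV : standard_space R V)
  (X : Omega -> set V)
  (hX0 : forall w, X w !=set0) (hX : graph_measurable (F 0) X)
  (f : Omega -> V -> V) (hf : forall w x, X w x -> X (T w) (f w x))
  (Y : Omega -> set V)
  (hY0 : forall w, Y w !=set0) (hYX : forall w, Y w `<=` X w)
  (rho : forall w, metric_on R (Y w))
  (hsep : forall w, separable_space (metric_sub (rho w)))
  (A1 : measurable_fun setT
    (fbar X f : g_sigma_algebraType (F 1) * V -> add_infty V))
  (A2a : graph_measurable (F 0) Y)
  (A2b : measurable_fun setT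
    (rhobar rho : g_sigma_algebraType (F 0) * V * V -> \bar R))
  (A2c : forall w, borel (metric_sub (rho w)) =
    preimage_set_system setT (sub_val (rho w)) measurable)
  (A2d : forall w x, Y w x -> Y (T w) (f w x))
  (A2d' : forall w, continuous (metric_sub_map (rho w) (rho (T w)) (A2d w)))
  (Om : nat -> set Omega)
  (hOm : forall m, F 0 (Om m)) (hOmS : forall m, Om m `<=` Om m.+1)
  (hOm1 : P (Om m) @[m --> \oo] --> 1%E)
  (A3a : forall m w, Om m w -> Xcomp T Tinv f X m w `<=` Y w /\
    compact (sub_val (rho w) @^-1` Xcomp T Tinv f X m w))
  (A3b : forall m w, Om m w -> forall x y,
    Xk T Tinv Y (- m.+1%:Z) w x -> Xk T Tinv Y (- m.+1%:Z) w y -> x <> y ->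
    rho w (fcomp T Tinv f m w x) (fcomp T Tinv f m w y)
      < rho (Tpow T Tinv (- m.+1%:Z) w) x y) :
  exists xi : Omega -> V,
    [/\ [/\ measurable_fun setT (xi : g_sigma_algebraType (F 0) -> V),
            forall w, Y w (xi w),
            {ae P, forall w, xi (T w) = f w (xi w)}
          & {ae P, forall w,
              ereal_sup [set (rho w (xi w) (fcomp T Tinv f m w x))%:E |
                         x in Xk T Tinv X (- m.+1%:Z) w]
                @[m --> within [set m | (first_index Om w <= m)%N] \oo]
              --> 0%E}]
      & forall eta : Omega -> V,
          (forall w, X w (eta w)) ->
          {ae P, forall w, eta (T w) = f w (eta w)} ->
          {ae P, forall w, eta w = xi w}].
Proof.
have [[TK TinvK] mT mTinv PT PTinv] := hT.
have [Fsig Fm Fle Fnull Fshift] := hF.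
have negF0 N : P.-negligible N -> F 0 N.
  move=> nN; have mN := hP _ nN; apply: (Fnull 0 N mN).
  exact: measure_negligible mN nN.
(* Completeness of [P] puts all negligible sets into [F 0], so Marczewski's argument applies to
   [F 0] itself. *)
have suslinF0 A : suslin (measurable : set_system (g_sigma_algebraType (F 0))) A ->
    F 0 A.
  by rewrite -(sub_sigmaE (F 0) (Fsig 0)); exact: (suslin_complete P _ (Fsig 0) (Fm 0) negF0).
have mF0 A : F 0 A -> measurable (A : set (g_sigma_algebraType (F 0))).
  exact: sub_gen_smallest.
have mT01 : measurable_fun setT
    (Tinv : g_sigma_algebraType (F 0) -> g_sigma_algebraType (F 1)).
  move=> _ B; rewrite -[measurable B]/(<<s F 1 >> B) (sigma_algebra_id (Fsig 1)).
  rewrite -[F 1]/(F (0 + 1)) Fshift setTI => -[A FA <-].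
  rewrite (_ : Tinv @^-1` _ = A); first exact: mF0.
  by apply/seteqP; split => w /=; rewrite TinvK.
have mT00 : measurable_fun setT
    (Tinv : g_sigma_algebraType (F 0) -> g_sigma_algebraType (F 0)).
  move=> _ B; rewrite -[measurable B]/(<<s F 0 >> B) (sigma_algebra_id (Fsig 0)).
  move=> F0B; apply: mT01 => //.
  by move: (Fle 0 1 isT B F0B); exact: sub_gen_smallest.
pose K := attractor T Tinv f X.
have OmW m n w : (m <= n)%N -> Om m w -> Om n w.
  elim: n => [|n IH]; first by rewrite leqn0 => /eqP->.
  by rewrite leq_eqVlt => /orP[/eqP->//|]; rewrite ltnS => /IH/[apply]; exact: hOmS.
pose reached w := exists N, Om N w.
have ec w : reached w -> eventually_compact (T := T) (Tinv := Tinv) (f := f)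
    (X := X) (rho := rho) w.
  by move=> [N HN]; exists N => m Nm; apply: A3a; exact: OmW HN.
have ae_reached : {ae P, forall w, reached w}.
  have mOm m : measurable (Om m) by apply: Fm (hOm m).
  have mU : measurable (\bigcup_m Om m) by exact: bigcupT_measurable.
  exists (~` \bigcup_m Om m); split; first exact: measurableC.
    have cvgU : P (Om m) @[m --> \oo] --> P (\bigcup_m Om m).
      apply: nondecreasing_cvg_mu => // m n mn; apply/subsetPset => w.
      exact: OmW.
    rewrite probability_setC// -(cvg_unique _ hOm1 cvgU) ?subee//.
  by move=> w nw [N _ HN]; apply: nw; exists N.
have ae_orbit := ae_iter P Tinv mTinv PTinv _ ae_reached.
have {}ae_orbit : {ae P, forall w, (forall n, reached (iter n Tinv w)) /\
    forall n, eventually_compact (T := T) (Tinv := Tinv) (f := f)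
    (X := X) (rho := rho) (iter n Tinv w)}.
  by apply: filterS ae_orbit => w Hw; split => // n; exact/ec.
have KY w : reached w -> K w `<=` Y w.
  by move=> /ec; exact: attractorY.
(* The interval excludes [+oo], the value of [rhobar] outside [Y w]. *)
pose far c : set Omega := [set w | exists x y, [/\ K w x, K w y &
  [set` `]c%:E, +oo%E[] (rhobar rho (w, x, y))]].
have farP c w : reached w -> far c w <->
    exists x y, [/\ K w x, K w y & c < rho w x y].
  move=> rw; split => -[x [y [Kx Ky xy]]]; exists x, y; split => //.
    move: xy; rewrite /= /rhobar /= !mem_set; [|exact: (KY _ rw)..].
    by rewrite in_itv /= lte_fin => /andP[].
  rewrite /= /rhobar /= !mem_set; [|exact: (KY _ rw)..].
  by rewrite in_itv /= lte_fin xy ltry.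
have far_meas c : measurable (far c).
  apply: (Fm 0); apply: suslinF0.
  apply: (attractor_diameter_suslin hV TinvK hf mT01 mT00 A1 (rhobar rho)) => //.
  exact: emeasurable_itv.
(* Lift both points [m.+1] steps back inside the attractor. Positive distance keeps the lifts
   distinct, so (A3b) makes them strictly farther apart. *)
have preimages w x y m : (forall n, reached (iter n Tinv w)) -> Om m w ->
    K w x -> K w y -> 0 < rho w x y -> exists x' y',
    [/\ K (iter m.+1 Tinv w) x', K (iter m.+1 Tinv w) y' &
        rho w x y < rho (iter m.+1 Tinv w) x' y'].
  move=> rw Omw Kx Ky xy.
  have ecw n := ec _ (rw n).
  have [x' Kx' x'x] := attractor_fcomp TK TinvK hf A2d A2d' m w x ecw Kx.
  have [y' Ky' y'y] := attractor_fcomp TK TinvK hf A2d A2d' m w y ecw Ky.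
  exists x', y'; split => //; rewrite -x'x -y'y; apply: A3b => //.
  - exact: (KY _ (rw m.+1)).
  - exact: (KY _ (rw m.+1)).
  - move=> xy'; move: xy; rewrite -x'x -y'y xy' mdist_onxx ?ltxx//.
    by rewrite y'y; exact: (KY _ (rw 0%N)).
have ae_far c : 0 <= c ->
    {ae P, forall w, forall n, far c (iter n Tinv w) -> far c w}.
  move=> c0; apply: (ae_eventually_invariant P Tinv mTinv PTinv _ (far_meas c)).
  apply: filterS ae_orbit => w [rw _] /(farP _ _ (rw 0%N))[x [y [Kx Ky cxy]]].
  (* [N.+1] appears because index [m] goes back [m.+1] steps. *)
  have [N HN] := rw 0%N; exists N.+1 => -[//|m]; rewrite ltnS => Nm.
  have [|x' [y' [Kx' Ky' xy']]] := preimages w x y m rw (OmW _ _ _ Nm HN) Kx Ky.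
    exact: le_lt_trans cxy.
  by apply/(farP _ _ (rw m.+1)); exists x', y'; split => //; exact: lt_trans xy'.
(* Countably many thresholds share one null set. *)
have {}ae_far : {ae P, forall w, forall q : rat, 0 <= ratr q :> R ->
    forall n, far (ratr q) (iter n Tinv w) -> far (ratr q) w}.
  have : {ae P, forall w, forall k, let q : rat := odflt 0 (unpickle k) in
      0 <= ratr q :> R ->
      forall n, far (ratr q) (iter n Tinv w) -> far (ratr q) w}.
    apply: ae_foralln => k /=; set q := ratr _.
    have [q0|q0] := leP 0 q; last by apply: aeW => w.
    by apply: filterS (ae_far q q0) => w + _.
  by apply: filterS => w Hw q; have := Hw (pickle q); rewrite pickleK.
pose single w := exists2 x, Y w x & K w = [set x].
have ae_single : {ae P, forall w, single w}.
  apply: filterS2 ae_orbit ae_far => w [rw ecw] farw.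
  have [x [y [Kx Ky xy]]] := attractor_max TinvK hf hX0 w (ecw 0%N).
  (* A positive maximal distance would be exceeded [N.+1] steps back; a rational strictly between
     the two values contradicts [farw]. *)
  have xy0 : rho w x y <= 0.
    rewrite leNgt; apply/negP => xy_gt0.
    have [N HN] := rw 0%N.
    have [x' [y' [Kx' Ky' xy']]] := preimages w x y N rw HN Kx Ky xy_gt0.
    have [q] := rat_in_itvoo xy'; rewrite in_itv /= => /andP[xyq qxy'].
    have : far (ratr q) w.
      apply: (farw q (ltW (lt_trans xy_gt0 xyq)) N.+1).
      by apply/(farP _ _ (rw N.+1)); exists x', y'.
    move=> /(farP _ _ (rw 0%N))[a [b [Ka Kb]]].
    by rewrite ltNge (le_trans (xy _ _ Ka Kb))// ltW.
  have Yx := KY _ (rw 0%N) x Kx.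
  exists x => //; apply/seteqP; split => [z Kz|_ ->//].
  have Yz := KY _ (rw 0%N) z Kz.
  apply: (mdist_on_eq (m := rho w) Yz Yx); apply/eqP; rewrite eq_le metric_on_ge0// andbT.
  exact: le_trans (xy _ _ Kz Kx) xy0.
have [y0 y0Y] := choice hY0.
(* The default [y0 w] keeps [xi w] in [Y w] also on the exceptional null set. *)
pose xi w := xget (y0 w) [set x | Y w x /\ K w = [set x]].
have xiY w : Y w (xi w) by rewrite /xi; case: xgetP => [x _ []|].
have xiK w : single w -> K w = [set xi w].
  by move=> [x Yx Kx]; rewrite /xi; case: xgetP => [z _ []|/(_ x)/not_andP[]].
exists xi; split; first split => //.
- move=> _ B mB; rewrite setTI.
  pose H := [set w | exists x, K w x /\ B x].
  have F0H : measurable (H : set (g_sigma_algebraType (F 0))).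
    apply: mF0; apply: suslinF0.
    exact: (attractor_hit_suslin hV TinvK hf mT01 mT00 A1).
  have neg (A : set Omega) : (forall w, A w -> ~ single w) ->
      measurable (A : set (g_sigma_algebraType (F 0))).
    move=> nA; apply: mF0; apply: negF0.
    by apply: negligibleS ae_single => w /nA.
  (* The preimage of [B] differs from [H] only where the attractor is not a singleton, that is, by
     null sets belonging to [F 0]. *)
  rewrite (_ : _ @^-1` _ = (H `\` (H `\` xi @^-1` B)) `|` (xi @^-1` B `\` H)).
    apply: measurableU; [apply: measurableD => //|]; apply: neg => w.
      move=> [[x [Kx Bx]] nB] /xiK Kw; apply: nB.
      by move: Kx; rewrite Kw /= => <-.
    by move=> [/= Bw nH] /xiK Kw; apply: nH; exists (xi w); rewrite Kw.
  by rewrite setDD setIC setUIDK.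
- have := ae_iter P T mT PT _ ae_single; apply: filterS => w Hw.
  have Kw := xiK _ (Hw 0%N); have KTw := xiK _ (Hw 1%N).
  have : K (T w) (f w (xi w)).
    by apply: (attractor_image TK TinvK hf); rewrite -/K Kw.
  by rewrite KTw.
- apply: filterS2 ae_orbit ae_single => w [rw ecw] sw.
  have := attractor_sup_cvg TinvK hf hX0 w (xi w) (ecw 0%N) (xiK _ sw).
  (* The limit over all [m] implies the one restricted to [m] at least [first_index Om w]. *)
  apply: cvg_trans.
  rewrite (_ : (fun m => ereal_sup _) =
    fun m => ereal_sup [set (rho w (xi w) x)%:E | x in Xcomp T Tinv f X m w]).
    exact: cvg_app (cvg_within _).
  by apply/funext => m; rewrite /Xcomp image_comp.
- move=> eta etaX etaE.
  (* Only the null set where the equation fails is pulled back, so [eta] need not be measurable. *)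
  have ae_eta := ae_iter P Tinv mTinv PTinv _ etaE.
  apply: filterS2 ae_eta ae_single => w Hw sw.
  have : K w (eta w) by exact: (attractor_orbit TinvK).
  by rewrite (xiK _ sw).
Qed.
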